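(* Consider $\min_{u\in\mathcal U}P(u)$ with $P=h+\zeta+\mu\omega_{\mathcal U}$ and $\mu>0$, and the inexact non-Hilbertian accelerated proximal gradient (APG) method (Algorithm 2 in the context) with approximation errors $\{\delta_t\}_{t\ge0}$ and weights $$\alpha_0=1,\qquad\alpha_t=(1+\sqrt\theta)^{t-1}\sqrt\theta\quad(t\ge1),\qquad\theta:=\mu/\bar L.$$ Then for all $t\ge0$, $$P(z_t)-P^*\le(1+\sqrt\theta)^{-t}\,\bar L\,D_{\omega_{\mathcal U}}(u^*,u_0)+(1+\sqrt\theta)^{-t}\sum_{i=0}^t(1+\sqrt\theta)^i\delta_i.$$ In addition, suppose $h$ has the max-structure $h(u)=\max_{v\in\mathcal V}\bar\Psi(u,v)$ described in the context, $\mathcal U$ is bounded, and $(\hat h(u_t),\hat\nabla h(u_t))=(\bar\Psi(u_t,v_t),\nabla_u\bar\Psi(u_t,v_t))$ for all $t\ge0$, where $v_t\in\mathcal V$ satisfies $h(u_t)-\bar\Psi(u_t,v_t)\le\delta_t/2$. Then one can choose $\bar L=2L_h$ and obtain, for all $t\ge0$, $$\bar\Delta(z_t,\bar v_t)\le2(1+\sqrt\theta)^{-t}L_h\,\Omega_{\omega_{\mathcal U}}(u_0)+(1+\sqrt\theta)^{-t}\sum_{i=0}^t(1+\sqrt\theta)^i\delta_i,$$ where $\bar v_t:=A_t^{-1}\sum_{i=0}^t\alpha_iv_i$ and $\Omega_{\omega_{\mathcal U}}(u_0):=\max_{u\in\mathcal U}D_{\omega_{\mathcal U}}(u,u_0)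<+\infty$.
   Context: Setting. $\mathbb U$ is a finite-dimensional real normed space (dual norm $\|\cdot\|_*$) and $\mathcal U\subseteq\mathbb U$ is nonempty, closed, convex. A distance generating function (DGF) on $\mathcal U$ is $\omega_{\mathcal U}:\mathbb U\to\mathbb R\cup\{+\infty\}$ that is continuous and 1-strongly convex on $\mathcal U$ and essentially smooth (continuously differentiable on $\operatorname{int}\operatorname{dom}\omega_{\mathcal U}$, with $\|\nabla\omega_{\mathcal U}(u_k)\|_*\to+\infty$ whenever $u_k\in\operatorname{int}\operatorname{dom}\omega_{\mathcal U}$ converges to a boundary point of $\operatorname{dom}\omega_{\mathcal U}$). $\mathcal U^o:=\mathcal U\cap\operatorname{int}\operatorname{dom}\omega_{\mathcal U}$ and $D_{\omega_{\mathcal U}}(u',u):=\omega_{\mathcal U}(u')-\omega_{\mathcal U}(u)-\langle\nabla\omega_{\mathcal U}(u),u'-u\rangle$. $P^*:=\min_{u\in\mathcal U}\{P(u):=h(u)+\zeta(u)+\mu\omega_{\mathcal U}(u)\}$, where $h,\zeta$ are convex on $\mathcal U$; $h$ is differentiable on an open set $\mathcal U'\supseteq\mathcal U$ with $\nabla h$ $L_h$-Lipschitz on $\mathcal U$; $\zeta:\mathbb U\to\mathbb R\cup\{+\infty\}$ is closed and for all $\xi\in\mathbb U^*$, $\alpha>0$ the problem $\min_{u\in\mathcal U}\zeta(u)+\langle\xi,u\rangle+\alpha^{-1}\omega_{\mathcal U}(u)$ has a unique (easily computable) solution in $\mathcal U^o\cap\operatorname{dom}\zeta$. The optimal solution is denoted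 $u^*\in\mathcal U^o$. Inexact model. $(\hat h(u),\hat\nabla h(u))\in\mathbb R\times\mathbb U^*$ is a $(\delta,\bar L)$-FOA of $h$ at $u\in\mathcal U$ if for all $u'\in\mathcal U$: $\hat h(u)+\langle\hat\nabla h(u),u'-u\rangle\le h(u')\le\hat h(u)+\langle\hat\nabla h(u),u'-u\rangle+(\bar L/2)\|u'-u\|^2+\delta$. Max-structure. $h(u)=\max_{v\in\mathcal V}\bar\Psi(u,v)$ for $u\in\mathcal U'$, where $\mathcal V$ is a nonempty compact convex subset, contained in an open set $\mathcal V'$, of a finite-dimensional normed space; $\bar\Psi:\mathcal U'\times\mathcal V'\to\mathbb R$ is jointly continuous; for $v\in\mathcal V$, $\bar\Psi(\cdot,v)$ is convex on $\mathcal U$ and differentiable on $\mathcal U'$, with $\|\nabla_u\bar\Psi(u,v)-\nabla_u\bar\Psi(u',v)\|_*\le L_{uu}\|u-u'\|$ and $\|\nabla_u\bar\Psi(u,v)-\nabla_u\bar\Psi(u,v')\|_*\le L_{uv}\|v-v'\|$ for $u,u'\in\mathcal U$, $v,v'\in\mathcal V$; $\bar\Psi(u,\cdot)$ is $\rho$-strongly concave on $\mathcal V$ for $u\in\mathcal U$, $\rho>0$. In this case $L_h:=L_{uu}+L_{uv}^2/\rho$. Dual function: $\Xi(v):=\inf_{u\in\mathcal U}\bar\Psi(u,v)+\zeta(u)+\mu\omega_{\mathcal U}(u)$; duality gap: $\bar\Delta(u,v):=P(u)-\Xi(v)$. Algorithm 2. Input: errors $\delta_t\ge0$, $\bar L\ge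 L_h$, weights $\alpha_t$; $A_t:=\sum_{i=0}^t\alpha_i$, $\tau_t:=\alpha_t/A_t$. Start: $u_0\in\mathcal U^o$, $s_0=\hat\nabla h(u_0)$ with $(\hat h(u_0),\hat\nabla h(u_0))$ a $(\delta_0,\bar L)$-FOA of $h$ at $u_0$, $z_0=\arg\min_{u\in\mathcal U}\langle s_0,u\rangle+\zeta(u)+\mu\omega_{\mathcal U}(u)+\bar LD_{\omega_{\mathcal U}}(u,u_0)$. For $t=0,1,\dots$: $\bar u_{t+1}=\arg\min_{u\in\mathcal U}\langle s_t,u\rangle+A_t(\zeta(u)+\mu\omega_{\mathcal U}(u))+\bar LD_{\omega_{\mathcal U}}(u,u_0)$; $u_{t+1}=(1-\tau_{t+1})z_t+\tau_{t+1}\bar u_{t+1}$; compute a $(\delta_{t+1},\bar L)$-FOA $(\hat h(u_{t+1}),\hat\nabla h(u_{t+1}))$ of $h$ at $u_{t+1}$; $s_{t+1}=s_t+\alpha_{t+1}\hat\nabla h(u_{t+1})$; $w_{t+1}=\arg\min_{u\in\mathcal U}\alpha_{t+1}(\langle\hat\nabla h(u_{t+1}),u\rangle+\zeta(u)+\mu\omega_{\mathcal U}(u))+(A_t\mu+\bar L)D_{\omega_{\mathcal U}}(u,\bar u_{t+1})$; $z_{t+1}=(1-\tau_{t+1})z_t+\tau_{t+1}w_{t+1}$. *)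

(* Defs.v *)
From HB Require Import structures.
From mathcomp Require Export all_boot all_order all_algebra.
From mathcomp Require Export all_classical all_reals all_analysis.

Set Implicit Arguments.
Unset Strict Implicit.
Unset Printing Implicit Defensive.
Import Order.TTheory GRing.Theory Num.Theory.
Import numFieldNormedType.Exports.

Local Open Scope classical_set_scope.
Local Open Scope ring_scope.

(* The dual space of E is rendered as {linear E -> R^o}: in finite dimension
   every linear form is continuous. *)
Definition finite_dim (R : realType) (E : lmodType R) : Prop :=
  exists (n : nat) (b : 'I_n -> E),
    forall x, exists c : 'I_n -> R, x = \sum_i c i *: b i.

Definition dual_norm (R : realType) (E : normedModType R) (f : E -> R)
    : \bar R :=
  ereal_sup [set `|f x|%:E | x in [set x : E | `|x| <= 1]].

(** ** Convexity, closedness, minimizers *)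

Definition strongly_convex_on (R : realType) (E : normedModType R) (rho : R)
    (A : set E) (f : E -> R) : Prop :=
  forall x y (t : R), A x -> A y -> 0 <= t <= 1 ->
    f (t *: x + (1 - t) *: y) <=
      t * f x + (1 - t) * f y - rho / 2 * (t * (1 - t)) * `|x - y| ^+ 2.

(* Convexity of an extended-real-valued function; 0 * +oo = 0 in \bar R, so
   the cases t = 0 and t = 1 carry no content. *)
Definition econvex_on (R : realType) (E : lmodType R) (A : set E)
    (f : E -> \bar R) : Prop :=
  forall x y (t : R), A x -> A y -> 0 <= t <= 1 ->
    (f (t *: x + (1 - t) *: y)%R <= t%:E * f x + (1 - t)%:E * f y)%E.

Definition closed_function (R : realType) (E : normedModType R)
    (f : E -> \bar R) : Prop :=
  closed [set p : E * R^o | (f p.1 <= p.2%:E)%E].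

Definition edom (R : realType) (T : Type) (f : T -> \bar R) : set T :=
  [set x | (f x < +oo)%E].

Definition is_argmin (R : realType) (T : Type) (A : set T) (f : T -> \bar R)
    (x : T) : Prop :=
  A x /\ forall y, A y -> (f x <= f y)%E.

(** ** Distance generating functions *)

(* Meaningful at interior points of the domain of w, where w is finite on a
   neighbourhood. *)
Definition egrad (R : realType) (E : normedModType R) (w : E -> \bar R)
    (u : E) : {linear E -> R^o} :=
  'd (fun x => fine (w x) : R^o) u.

Definition essentially_smooth (R : realType) (E : normedModType R)
    (w : E -> \bar R) : Prop :=
  let D := edom w in
  [/\ forall u, D^° u -> differentiable (fun x => fine (w x) : R^o) u,
      forall u, D^° u ->
        (fun x => dual_norm (egrad w x \- egrad w u)) @ u --> 0%E
    & forall (x : nat -> E) (y : E),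
        (forall k, D^° (x k)) -> x @ \oo --> y ->
        (closure D `\` D^°) y ->
        (fun k => dual_norm (egrad w (x k))) @ \oo --> +oo%E].

(* Continuity and strong convexity on U are those of a real-valued function:
   w is finite on U. *)
Record is_dgf (R : realType) (E : normedModType R) (U : set E)
    (w : E -> \bar R) : Prop := {
  dgf_neqNy : forall u, w u != -oo%E ;
  dgf_fin : U `<=` edom w ;
  dgf_continuous : {within U, continuous (fun x => fine (w x) : R^o)} ;
  dgf_strongly_convex : strongly_convex_on 1 U (fun x => fine (w x)) ;
  dgf_essentially_smooth : essentially_smooth w
}.

Definition dgf_interior (R : realType) (E : normedModType R) (U : set E)
    (w : E -> \bar R) : set E :=
  U `&` (edom w)^°.

Definition bregman (R : realType) (E : normedModType R) (w : E -> \bar R)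
    (u' u : E) : \bar R :=
  (w u' - w u - (egrad w u (u' - u))%:E)%E.

(** ** The problem and the inexact model *)

Definition objective (R : realType) (E : normedModType R) (h : E -> R)
    (zeta w : E -> \bar R) (mu : R) (u : E) : \bar R :=
  ((h u)%:E + zeta u + mu%:E * w u)%E.

Definition optimal_value (R : realType) (E : normedModType R) (U : set E)
    (h : E -> R) (zeta w : E -> \bar R) (mu : R) : \bar R :=
  ereal_inf [set objective h zeta w mu u | u in U].

Definition prox_solvable (R : realType) (E : normedModType R) (U : set E)
    (zeta w : E -> \bar R) : Prop :=
  forall (xi : {linear E -> R^o}) (a : R), 0 < a ->
    let f := fun u => (zeta u + (xi u)%:E + a^-1%:E * w u)%E in
    exists u, [/\ is_argmin U f u,
                  (forall u', is_argmin U f u' -> u' = u),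
                  dgf_interior U w u
                & edom zeta u].

Definition gradient_lipschitz (R : realType) (E : normedModType R)
    (U : set E) (h : E -> R) (L : R) : Prop :=
  forall u u', U u -> U u' ->
    (dual_norm ('d (h : E -> R^o) u \- 'd (h : E -> R^o) u')%R
       <= (L * `|u - u'|)%:E)%E.

Definition is_FOA (R : realType) (E : normedModType R) (U : set E)
    (h : E -> R) (delta L : R) (u : E) (hh : R) (g : {linear E -> R^o})
    : Prop :=
  U u /\
  forall u', U u' ->
    hh + g (u' - u) <= h u' /\
    h u' <= hh + g (u' - u) + L / 2 * `|u' - u| ^+ 2 + delta.

(** ** The accelerated proximal gradient method *)

Definition weight (R : realType) (theta : R) (t : nat) : R :=
  if t is t'.+1 then (1 + Num.sqrt theta) ^+ t' * Num.sqrt theta else 1.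

Definition weight_sum (R : realType) (alpha : nat -> R) (t : nat) : R :=
  \sum_(i < t.+1) alpha i.

(* The update rules of the method, given the slopes g t used at u t; the
   accuracy of the model (is_FOA) is imposed or proved separately. The values
   ubar 0 and w 0 are not used. *)
Record APG_updates (R : realType) (E : normedModType R) (U : set E)
    (zeta omega : E -> \bar R) (mu Lbar : R) (alpha : nat -> R)
    (g : nat -> {linear E -> R^o}) (s : nat -> E -> R)
    (u ubar w z : nat -> E) : Prop := {
  APG_u0 : dgf_interior U omega (u 0%N) ;
  APG_s0 : forall x, s 0%N x = g 0%N x ;
  APG_z0 : is_argmin U (fun x =>
      (s 0%N x)%:E + zeta x + mu%:E * omega x
      + Lbar%:E * bregman omega x (u 0%N))%E (z 0%N) ;
  APG_ubar : forall t, is_argmin U (fun x =>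
      (s t x)%:E + (weight_sum alpha t)%:E * (zeta x + mu%:E * omega x)
      + Lbar%:E * bregman omega x (u 0%N))%E (ubar t.+1) ;
  APG_u : forall t, let tau := alpha t.+1 / weight_sum alpha t.+1 in
      u t.+1 = (1 - tau) *: z t + tau *: ubar t.+1 ;
  APG_s : forall t x, s t.+1 x = s t x + alpha t.+1 * g t.+1 x ;
  APG_w : forall t, is_argmin U (fun x =>
      (alpha t.+1)%:E * ((g t.+1 x)%:E + zeta x + mu%:E * omega x)
      + (weight_sum alpha t * mu + Lbar)%:E * bregman omega x (ubar t.+1))%E
      (w t.+1) ;
  APG_z : forall t, let tau := alpha t.+1 / weight_sum alpha t.+1 in
      z t.+1 = (1 - tau) *: z t + tau *: w t.+1
}.

(** ** Max-structure *)

Record max_structure (R : realType) (E F : normedModType R) (U U' : set E)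
    (V V' : set F) (h : E -> R) (Psi : E -> F -> R) (Luu Luv rho : R)
    : Prop := {
  max_V_neq0 : V !=set0 ;
  max_V_compact : compact V ;
  max_V_convex : convex_set V ;
  max_V'_open : open V' ;
  max_V_sub : V `<=` V' ;
  max_Luu_ge0 : 0 <= Luu ;
  max_Luv_ge0 : 0 <= Luv ;
  max_rho_gt0 : 0 < rho ;
  max_eq : forall u, U' u ->
    (exists2 v, V v & h u = Psi u v) /\ (forall v, V v -> Psi u v <= h u) ;
  max_continuous :
    {within U' `*` V', continuous (fun p : E * F => Psi p.1 p.2 : R^o)} ;
  max_convex : forall v, V v ->
    convex_function (E := E) U (Psi ^~ v : E -> R^o) ;
  max_differentiable : forall u v, U' u -> V v ->
    differentiable (Psi ^~ v : E -> R^o) u ;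
  max_lipschitz_u : forall u u' v, U u -> U u' -> V v ->
    (dual_norm ('d (Psi ^~ v : E -> R^o) u \- 'd (Psi ^~ v : E -> R^o) u')%R
       <= (Luu * `|u - u'|)%:E)%E ;
  max_lipschitz_v : forall u v v', U u -> V v -> V v' ->
    (dual_norm ('d (Psi ^~ v : E -> R^o) u \- 'd (Psi ^~ v' : E -> R^o) u)%R
       <= (Luv * `|v - v'|)%:E)%E ;
  max_strongly_concave : forall u, U u ->
    strongly_convex_on rho V (fun v => - Psi u v)
}.

Definition dual_function (R : realType) (E F : normedModType R) (U : set E)
    (Psi : E -> F -> R) (zeta w : E -> \bar R) (mu : R) (v : F) : \bar R :=
  ereal_inf [set ((Psi u v)%:E + zeta u + mu%:E * w u)%E | u in U].

Definition duality_gap (R : realType) (E F : normedModType R) (U : set E)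
    (h : E -> R) (Psi : E -> F -> R) (zeta w : E -> \bar R) (mu : R)
    (u : E) (v : F) : \bar R :=
  (objective h zeta w mu u - dual_function U Psi zeta w mu v)%E.

Definition bregman_radius (R : realType) (E : normedModType R) (U : set E)
    (w : E -> \bar R) (u0 : E) : \bar R :=
  ereal_sup [set bregman w u u0 | u in U].

(* Main.v *)
Require Import Defs.
From mathcomp Require Import ring lra.

Set Implicit Arguments.
Unset Strict Implicit.
Unset Printing Implicit Defensive.
Import Order.TTheory GRing.Theory Num.Theory.
Import numFieldNormedType.Exports.

Local Open Scope classical_set_scope.
Local Open Scope ring_scope.

(** The proof is an estimate-sequence argument. Write phi = zeta + mu omega,
    A_t for the sum of the weights up to t, l_i for the affine model of h
    built at u_i, D for the Bregman distance of omega, and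
      psi_t(x) = sum_(i <= t) alpha_i l_i(x) + A_t phi(x) + Lbar D(x, u_0).
    Everything follows from the single inequality
      A_t P(z_t) <= psi_t(x) + sum_(i <= t) A_i delta_i
    for all x of U where zeta is finite (estimate_sequence_bound, apg_bound).

    The inequality is an induction on t. The function psi_t is an affine
    function, plus A_t zeta, plus (A_t mu + Lbar) omega, so its minimizer
    ubar_(t+1) satisfies
      psi_t(x) >= psi_t(ubar_(t+1)) + (A_t mu + Lbar) D(x, ubar_(t+1));
    this is where mu > 0 pays off. After adding the new term
    alpha_(t+1) (l_(t+1) + phi), the right-hand side is least at w_(t+1).
    Convexity of l_(t+1) + phi merges the point z_t (of weight A_t) and the
    point w_(t+1) (of weight alpha_(t+1)) into z_(t+1). Since
    z_(t+1) - u_(t+1) = tau_(t+1) (w_(t+1) - ubar_(t+1)), the quadratic error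
    of the model at z_(t+1) is absorbed by D(w_(t+1), ubar_(t+1)) as soon as
      Lbar alpha_(t+1)^2 <= (A_t mu + Lbar) A_(t+1).
    The geometric weights satisfy this and have A_t = (1 + sqrt theta)^t
    (weight_growth, weight_sumE).

    For the rate on P, take x = ustar and use l_i <= h. For the duality gap,
    l_i(x) <= Psi(x, v_i), and concavity of Psi(x, .) bounds the weighted sum
    of these values by A_t Psi(x, vbar_t); the infimum over x is then the dual
    function at vbar_t. That inexact maximization yields a first-order
    approximation with constant 2 L_h is max_structure_FOA. The radius Omega
    is attained because U is compact and D(., u_0) is continuous on it.

    The gradient of omega may be used at ubar_(t+1) because ubar_(t+1) solves
    one of the proximal problems, whose unique solution lies in the interior
    of the domain of omega. The extended-valued problems are turned into
    real-valued ones on the set of points of U where zeta is finite: all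
    minimizers belong to it (is_argmin_finite). *)

(** * Convexity and dual norms *)

Lemma convex_setP (R : realType) (E : lmodType R) (U : set E) :
  convex_set U -> forall x y (t : R), U x -> U y -> 0 <= t <= 1 ->
  U ((1 - t) *: x + t *: y).
Proof.
move=> cU x y t Ux Uy /andP[t0 t1].
pose k := Itv01 t0 t1.
have := cU y x k (mem_set Uy) (mem_set Ux).
by rewrite inE /conv /= addrC.
Qed.

Lemma convex_functionP (R : realType) (E : lmodType R) (U : set E)
  (f : E -> R) :
  convex_function (E := E) U (f : E -> R^o) ->
  forall x y (t : R), U x -> U y -> 0 <= t <= 1 ->
  f ((1 - t) *: x + t *: y) <= (1 - t) * f x + t * f y.
Proof.
move=> cf x y t Ux Uy /andP[t0 t1].
pose k := Itv01 t0 t1.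
have := cf k y x (mem_set Uy) (mem_set Ux).
by rewrite /conv /= addrC [X in _ <= X]addrC.
Qed.

(** Jensen's inequality, obtained by updating the running mean: the mean of
    t.+2 points is the combination of the previous mean and the new point with
    ratio alpha t.+1 over the new sum of weights. *)
Lemma weighted_mean_concave (R : realType) (F : normedModType R) (V : set F)
    (f : F -> R) (alpha : nat -> R) (v : nat -> F) :
  convex_set V ->
  (forall x y (t : R), V x -> V y -> 0 <= t <= 1 ->
    (1 - t) * f x + t * f y <= f ((1 - t) *: x + t *: y)) ->
  0 < alpha 0%N -> (forall t, 0 <= alpha t) -> (forall t, V (v t)) ->
  forall t, let A := weight_sum alpha t in
  let vbar := A^-1 *: \sum_(i < t.+1) alpha i *: v i in
  V vbar /\ \sum_(i < t.+1) alpha i * f (v i) <= A * f vbar.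
Proof.
move=> cV cf a0 a_ge0 Vv; elim=> [|t [IHV IH]] /=.
  rewrite /weight_sum !big_ord1 scalerA mulVf ?gt_eqF// scale1r.
  by split.
have A0 : 0 < weight_sum alpha t.
  rewrite /weight_sum big_ord_recl; apply: ltr_wpDr => //.
  by apply: sumr_ge0 => i _; exact: a_ge0.
have AS : weight_sum alpha t.+1 = weight_sum alpha t + alpha t.+1.
  by rewrite /weight_sum big_ord_recr.
have A'0 : 0 < weight_sum alpha t.+1 by rewrite AS ltr_wpDr.
pose T := alpha t.+1 / weight_sum alpha t.+1.
have T01 : 0 <= T <= 1.
  by rewrite divr_ge0 ?(ltW A'0)//= ler_pdivrMr// mul1r AS lerDr ltW.
have TA : weight_sum alpha t.+1 * T = alpha t.+1.
  by rewrite mulrC divfK// gt_eqF.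
have TB : weight_sum alpha t.+1 * (1 - T) = weight_sum alpha t.
  by rewrite mulrBr TA mulr1 AS addrK.
set vb := _ *: _ in IHV IH.
have -> : (weight_sum alpha t.+1)^-1 *: \sum_(i < t.+2) alpha i *: v i =
    (1 - T) *: vb + T *: v t.+1.
  apply: (scalerI (lt0r_neq0 A'0)).
  rewrite scalerA divff ?gt_eqF// scale1r scalerDr !scalerA TA TB.
  by rewrite divff ?gt_eqF// scale1r big_ord_recr.
split; first exact: convex_setP.
rewrite big_ord_recr/=.
apply: le_trans (ler_wpM2l (ltW A'0) (cf _ _ _ IHV (Vv t.+1) T01)).
by rewrite mulrDr (mulrA _ (1 - T)) TB (mulrA _ T) TA lerD2r.
Qed.

Lemma dual_norm_le (R : realType) (E : normedModType R)
    (f : {linear E -> R^o}) (c : R) (x : E) :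
  (dual_norm f <= c%:E)%E -> `|f x| <= c * `|x|.
Proof.
move=> fc; have [->|x0] := eqVneq x 0; first by rewrite linear0 !normr0 mulr0.
have nx : 0 < `|x| by rewrite normr_gt0.
have : (`|f (`|x|^-1 *: x)|%:E <= c%:E)%E.
  apply: le_trans fc; apply: ereal_sup_ubound; exists (`|x|^-1 *: x) => //=.
  by rewrite normrZ normfV normr_id mulVf ?gt_eqF.
rewrite lee_fin linearZ normrZ normfV normr_id.
by rewrite ler_pdivrMl// mulrC.
Qed.

(** * Gradients and slopes along segments *)

(** The difference quotient at t is at most a + b * t; let t tend to 0 from the
    right. The slack b absorbs the quadratic term of strong convexity. *)
Lemma diff_le_of_slope (R : realType) (E : normedModType R) (f : E -> R^o)
    (u d : E) (a b : R) :
  differentiable f u ->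
  (forall t, 0 < t <= 1 -> f (u + t *: d) - f u <= t * (a + b * t)) ->
  'd f u d <= a.
Proof.
move=> df slope; rewrite -deriveE//.
have cv1 : (t^-1 *: (f (t *: d + u) - f u) : R) @[t --> (0:R)^'+] --> 'D_d f u.
  by apply: cvg_dnbhs_at_right; exact: diff_derivable.
have cv2 : a + b * t @[t --> (0:R)^'+] --> a + b * 0.
  apply: cvgD; first exact: cvg_cst.
  by apply: cvgMr; apply: cvg_at_right_filter; exact: cvg_id.
rewrite -[leRHS]addr0 -(mulr0 b).
apply: (ler_cvg_to cv1 cv2); near=> t.
have t0 : 0 < t by near: t; exact: nbhs_right_gt.
have t1 : t <= 1 by near: t; exact: nbhs_right_le.
have := slope t; rewrite t0 t1 => /(_ isT).
by rewrite (addrC u) /GRing.scale/= ler_pdivrMl.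
Unshelve. all: by end_near.
Qed.

Lemma diff_ge_of_slope (R : realType) (E : normedModType R) (f : E -> R^o)
    (u d : E) (a : R) :
  differentiable f u ->
  (forall t, 0 < t <= 1 -> t * a <= f (u + t *: d) - f u) ->
  a <= 'd f u d.
Proof.
move=> df slope.
have dNf : differentiable (- f) u by exact: differentiableN.
rewrite -lerN2.
have -> : - 'd f u d = 'd (- f) u d by rewrite diffN.
apply: (@diff_le_of_slope _ _ _ _ _ _ 0) => // t t01.
rewrite mul0r addr0 mulrN.
change (- f (u + t *: d) - - f u <= - (t * a)).
by rewrite -opprD lerN2 slope.
Qed.

(** Strong convexity bounds the slope from y towards x at parameter t by
    f x - f y - rho / 2 * (1 - t) * `|x - y| ^+ 2; the derivative is its limit
    at t = 0. For rho = 0 this is the tangent inequality of convex functions. *)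
Lemma strongly_convex_on_gradient (R : realType) (E : normedModType R)
    (rho : R) (A : set E) (f : E -> R^o) (x y : E) :
  strongly_convex_on rho A f -> A x -> A y -> differentiable f y ->
  f y + 'd f y (x - y) + rho / 2 * `|x - y| ^+ 2 <= f x.
Proof.
move=> scf Ax Ay dfy.
suff : 'd f y (x - y) <= f x - f y - rho / 2 * `|x - y| ^+ 2 by lra.
apply: (@diff_le_of_slope _ _ _ _ _ _ (rho / 2 * `|x - y| ^+ 2)) => // t.
move=> /andP[t0 t1].
have := scf x y t Ax Ay; rewrite (ltW t0) t1 => /(_ isT).
have -> : t *: x + (1 - t) *: y = y + t *: (x - y).
  by rewrite scalerBl scale1r scalerBr addrCA.
by set N := `|x - y| ^+ 2; nra.
Qed.

(** Comparing f v0 with the value at t *: v + (1 - t) *: v0 and dividing by t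
    loses a factor 1 - t, which tends to 1. *)
Lemma strongly_convex_min_growth (R : realType) (F : normedModType R) (rho : R)
    (V : set F) (f : F -> R) (v0 v : F) :
  strongly_convex_on rho V f -> convex_set V -> V v0 -> V v ->
  (forall v', V v' -> f v0 <= f v') ->
  rho / 2 * `|v - v0| ^+ 2 <= f v - f v0.
Proof.
move=> scf cV Vv0 Vv v0min.
set N := rho / 2 * _.
have slope (t : R) : 0 < t <= 1 -> (1 - t) * N <= f v - f v0.
  move=> /andP[t0 t1]; have t01 : 0 <= t <= 1 by rewrite ltW.
  have := scf v v0 t Vv Vv0 t01.
  have := v0min _ (convex_setP cV Vv0 Vv t01); rewrite addrC => h1 h2.
  rewrite -(ler_pM2l t0).
  have := le_trans h1 h2; rewrite /N; lra.
have [N0|N0] := leP N 0.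
  by apply: le_trans N0 _; have := v0min _ Vv; lra.
apply/ler_addgt0Pr => e e0.
(* For t <= e / N the lost term t * N is at most e. *)
have := slope (Num.min 1 (e / N)); rewrite lt_min ltr01 divr_gt0//= ge_min lexx/=.
move=> /(_ isT).
have : Num.min 1 (e / N) * N <= e.
  by rewrite -ler_pdivlMr// ge_min lexx orbT.
lra.
Qed.

(** First-order optimality with only W smooth: along the segment from p to x,
    the convex part phi grows at most linearly, so c * W cannot decrease
    faster than phi x - phi p allows. *)
Lemma minimizer_first_order (R : realType) (E : normedModType R) (D : set E)
    (phi : E -> R) (W : E -> R^o) (c : R) (p x : E) :
  (forall x y (t : R), D x -> D y -> 0 <= t <= 1 ->
    D ((1 - t) *: x + t *: y) /\
    phi ((1 - t) *: x + t *: y) <= (1 - t) * phi x + t * phi y) ->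
  0 < c -> differentiable W p -> D p -> D x ->
  (forall y, D y -> phi p + c * W p <= phi y + c * W y) ->
  phi p <= phi x + c * 'd W p (x - p).
Proof.
move=> convex c0 dW Dp Dx pmin.
suff : (phi p - phi x) / c <= 'd W p (x - p).
  by rewrite ler_pdivrMr// mulrC; lra.
apply: diff_ge_of_slope => // t /andP[t0 t1].
have t01 : 0 <= t <= 1 by rewrite ltW.
have [Dy yconvex] := convex p x t Dp Dx t01.
have := pmin _ Dy.
have yE : (1 - t) *: p + t *: x = p + t *: (x - p).
  by rewrite scalerBl scale1r scalerBr addrAC addrA.
rewrite yE in yconvex *.
rewrite mulrA ler_pdivrMr//.
set y := p + _ in yconvex *; lra.
Qed.

(** The function of t obtained by removing from f, on the segment, its
    linearization at x and the parabola L / 2 * t ^+ 2 has a nonpositive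
    derivative on [0, 1]. Here L is a Lipschitz constant along d, so that it
    contains the factor `|d| ^+ 2. *)
Lemma descent_along_segment (R : realType) (E : normedModType R) (f : E -> R^o)
    (x d : E) (L : R) :
  (forall t : R, 0 <= t <= 1 -> differentiable f (x + t *: d)) ->
  (forall t : R, 0 <= t <= 1 ->
    'd f (x + t *: d) d - 'd f x d <= L * t) ->
  f (x + d) <= f x + 'd f x d + L / 2.
Proof.
move=> df lip.
pose line : R -> E := fun t => x + t *: d.
pose phi : R -> R := fun t => f (line t) - t * 'd f x d - L / 2 * t ^+ 2.
have dphi (t : R) : 0 <= t <= 1 ->
    is_derive t 1 phi ('d f (line t) d - 'd f x d - L * t).
  move=> t01.
  have dline : is_diff t line ( *:%R^~ d).
    have -> : line = (cst x : R -> E) + ( *:%R^~ d) by [].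
    by apply: is_diff_eq; rewrite add0r.
  have dfl : differentiable f (line t) by exact: df.
  have dcomp : is_diff t (f \o line) ('d f (line t) \o *:%R^~ d).
    by apply: is_diff_comp; exact: differentiableP.
  have dcomp1 : is_derive t 1 (f \o line : R -> R) ('d f (line t) d).
    apply: DeriveDef; first exact/diff_derivable/ex_diff.
    by rewrite deriveE ?diff_val//= ?scale1r//; exact: ex_diff.
  have did : is_derive t 1 (@id R) 1 by exact: is_derive_id.
  rewrite /phi; apply: is_derive_eq.
  by rewrite /GRing.scale/=; field.
have := @MVT _ phi (fun t => 'd f (line t) d - 'd f x d - L * t) 0 1 ltr01.
move=> [||c c01].
- by move=> t t01; apply: dphi; move: t01; rewrite in_itv/= => /andP[/ltW-> /ltW->].
- apply: derivable_within_continuous => t; rewrite in_itv/= => t01.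
  by have := dphi t t01 => ?; exact: ex_derive.
have c01' : 0 <= c <= 1 by move: c01; rewrite in_itv/= => /andP[/ltW-> /ltW->].
have := lip c c01'; rewrite /phi /line scale1r scale0r addr0; lra.
Qed.

(** * Compactness in finite-dimensional normed spaces *)

Lemma coordinates_continuous (R : realType) (E : normedModType R) (n : nat)
    (b : 'I_n -> E) :
  continuous (fun c : 'rV[R]_n => \sum_i c 0 i *: b i).
Proof.
apply: continuous_big => [|i _ c]; first exact: add_continuous.
apply: (@continuous_comp _ _ _ (fun c : 'rV[R]_n => c 0 i) ( *:%R^~ (b i))).
  exact: coord_continuous.
exact: scalel_continuous.
Qed.

(** A spanning family of least cardinality is free: a relation with a nonzero
    coefficient at i makes the i-th vector redundant. *)
Lemma finite_dim_basis (R : realType) (E : lmodType R) :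
  finite_dim E ->
  exists (n : nat) (b : 'I_n -> E),
    (forall x, exists c : 'rV[R]_n, x = \sum_i c 0 i *: b i) /\
    (forall c : 'rV[R]_n, \sum_i c 0 i *: b i = 0 -> c = 0).
Proof.
move=> [n0 span0].
pose spans n := `[< exists b : 'I_n -> E,
  forall x, exists c : 'rV[R]_n, x = \sum_i c 0 i *: b i >].
have exspan : exists n, spans n.
  exists n0; apply/asboolP; case: span0 => b bspan; exists b => x.
  have [c ->] := bspan x; exists (\row_i c i).
  by apply: eq_bigr => i _; rewrite mxE.
case: (ex_minnP exspan) => n /asboolP[b bspan] nmin.
exists n, b; split=> // c c_ker.
apply/rowP => i; rewrite mxE; apply/eqP/negPn/negP => ci0.
(* A nonzero coefficient at i lets the other n vectors span E. *)
case: n b bspan nmin c c_ker i ci0 => [|n] b bspan nmin c c_ker i ci0.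
  by case: i ci0.
have /nmin : spans n; last by rewrite ltnn.
apply/asboolP; exists (fun j => b (lift i j)) => x.
have [d ->] := bspan x.
exists (\row_j (d 0 (lift i j) - d 0 i / c 0 i * c 0 (lift i j))).
have -> : \sum_j d 0 j *: b j =
    \sum_j d 0 j *: b j - (d 0 i / c 0 i) *: \sum_j c 0 j *: b j.
  by rewrite c_ker scaler0 subr0.
rewrite scaler_sumr -sumrB (bigD1_ord i)//= scalerA divfK// subrr add0r.
by apply: eq_bigr => j _; rewrite mxE scalerA scalerBl.
Qed.

(** The linear bijection phi from row vectors to E given by a basis is
    continuous, and its norm has a positive minimum on the unit sphere, which
    is compact. Hence phi^-1 is bounded, and A is the continuous image of a
    bounded closed set of row vectors. *)
Lemma finite_dim_bounded_closed_compact (R : realType) (E : normedModType R)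
    (A : set E) :
  finite_dim E -> bounded_set A -> closed A -> compact A.
Proof.
move=> /finite_dim_basis[n [b [bspan bfree]]] bndA clA.
pose phi (c : 'rV[R]_n) := \sum_i c 0 i *: b i.
have cphi : continuous phi by exact: coordinates_continuous.
have phiZ k c : phi (k *: c) = k *: phi c.
  by rewrite /phi scaler_sumr; apply: eq_bigr => i _; rewrite mxE scalerA.
have [M M0 phiM] : exists2 M : R, 0 <= M & forall c, `|c| <= M * `|phi c|.
  pose S := [set c : 'rV[R]_n | `|c| = 1].
  (* The unit sphere is empty when n = 0; then every c is 0. *)
  have [[e Se]|S0] := pselect (S !=set0); last first.
    exists 0 => // c; rewrite mul0r; have [->|c0] := eqVneq c 0.
      by rewrite normr0.
    exfalso; apply: S0; exists (`|c|^-1 *: c).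
    by rewrite /S/= normrZ normfV normr_id mulVf// normr_eq0.
  have cS : compact S.
    apply: bounded_closed_compact.
      by exists 1; split => // x x1 c; rewrite /S/= => ->; exact: ltW.
    apply: (@closed_comp _ _ (fun c : 'rV[R]_n => `|c|) [set 1]) => //.
    by move=> c _; exact: norm_continuous.
  have [|c0 Sc0 c0min] := @compact_EVT_min _ R (fun c => `|phi c|) S (ex_intro _ e Se) cS.
    apply: continuous_subspaceT => c.
    exact: (continuous_comp (cphi c) (@norm_continuous _ _ _)).
  have m0 : 0 < `|phi c0|.
    rewrite normr_gt0; apply/eqP => /bfree c00.
    by move: Sc0; rewrite inE /S/= c00 normr0 => /esym/eqP; rewrite oner_eq0.
  exists (`|phi c0|^-1); first by rewrite invr_ge0 ltW.
  move=> c; have [->|c1] := eqVneq c 0; first by rewrite normr0 mulr_ge0.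
  have nc : 0 < `|c| by rewrite normr_gt0.
  have : `|phi c0| <= `|phi (`|c|^-1 *: c)|.
    apply: c0min; rewrite inE /S/= normrZ normfV normr_id mulVf//.
    by rewrite gt_eqF.
  rewrite phiZ normrZ normfV normr_id ler_pdivlMl// => H.
  by rewrite ler_pdivlMl// mulrC.
have -> : A = phi @` (phi @^-1` A).
  apply/seteqP; split => [x Ax|_ [c Ac <-]//].
  by have [c xc] := bspan x; exists c; rewrite /= /phi -xc.
apply: continuous_compact; first exact: continuous_subspaceT.
apply: bounded_closed_compact; last by apply: closed_comp => // c _; exact: cphi.
have [K [Kr KA]] := bndA.
exists (M * (`|K| + 1)); split; first exact: num_real.
move=> x Mx c Ac; apply: le_trans (phiM c) _; apply: le_trans (ltW Mx).
apply: ler_wpM2l => //; apply: KA => //.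
by rewrite (le_lt_trans (ler_norm K))// ltrDl.
Qed.

(** * First-order approximation of a maximum *)

Lemma max_structure_linearization (R : realType) (E F : normedModType R)
    (U U' : set E) (V V' : set F) (h : E -> R) (Psi : E -> F -> R)
    (Luu Luv rho : R) (u u' : E) (v : F) :
  U `<=` U' -> max_structure U U' V V' h Psi Luu Luv rho ->
  U u -> U u' -> V v ->
  Psi u v + 'd (Psi ^~ v : E -> R^o) u (u' - u) <= Psi u' v.
Proof.
move=> UU' ms Uu Uu' Vv.
have sc0 : strongly_convex_on 0 U (Psi ^~ v).
  move=> x y t Ux Uy /andP[t0 t1]; rewrite !mul0r subr0.
  have t01' : 0 <= 1 - t <= 1 by lra.
  have := convex_functionP (max_convex ms Vv) Ux Uy t01'.
  by rewrite opprB addrCA subrr addr0.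
have := strongly_convex_on_gradient sc0 Uu' Uu
  (max_differentiable ms (UU' _ Uu) Vv).
by rewrite !mul0r addr0.
Qed.

(** The lower bound is the tangent inequality of Psi(., v). For the upper bound,
    let v' maximize Psi(u', .) and vs maximize Psi(u, .), and let d = u' - u.
    The lemma descent_along_segment, for Psi(., v'), gives the term in Luu.
    Passing from the gradient at (u, v') to the one at (u, v) costs at most
    Luv (`|v' - vs| + `|v - vs|) `|d|. By Young's inequality each of the two
    parts is at most Luv^2 / (2 rho) `|d|^2 plus rho / 2 times a squared
    distance to vs. By strong concavity these squared distances are paid for by
    h u - Psi u v' and by h u - Psi u v <= delta / 2 respectively.
    The two Young terms add up to Luv^2 / rho `|d|^2, twice the share of
    Luv^2 / rho in L_h / 2 `|d|^2: hence the constant 2 L_h. *)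
Lemma max_structure_FOA (R : realType) (E F : normedModType R)
    (U U' : set E) (V V' : set F) (h : E -> R) (Psi : E -> F -> R)
    (Luu Luv rho delta : R) (u : E) (v : F) (g : {linear E -> R^o}) :
  convex_set U -> U `<=` U' ->
  max_structure U U' V V' h Psi Luu Luv rho ->
  U u -> V v -> h u - Psi u v <= delta / 2 ->
  (forall x, g x = 'd (Psi ^~ v : E -> R^o) u x) ->
  is_FOA U h delta (2 * (Luu + Luv ^+ 2 / rho)) u (Psi u v) g.
Proof.
move=> cU UU' ms Uu Vv acc gE; split=> // u' Uu'; rewrite gE; split.
  have [_ /(_ v Vv) hmax] := max_eq ms (UU' _ Uu').
  exact: le_trans (max_structure_linearization UU' ms Uu Uu' Vv) hmax.
have [[v' Vv' hu'] _] := max_eq ms (UU' _ Uu').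
have [[vs Vvs hu] hmax] := max_eq ms (UU' _ Uu).
rewrite hu'; set d := u' - u.
have Luv0 := max_Luv_ge0 ms; have rho0 := max_rho_gt0 ms.
have desc : Psi (u + d) v' <=
    Psi u v' + 'd (Psi ^~ v' : E -> R^o) u d + Luu * `|d| ^+ 2 / 2.
  have Ut (t : R) : 0 <= t <= 1 -> U (u + t *: d).
    move=> t01; have := convex_setP cU Uu Uu' t01.
    by rewrite /d scalerBl scale1r scalerBr addrAC addrA.
  apply: (@descent_along_segment _ _ (Psi ^~ v' : E -> R^o)) => t t01.
    by apply: (max_differentiable ms) => //; exact: UU' (Ut _ t01).
  have := dual_norm_le d (max_lipschitz_u ms (Ut t t01) Uu Vv').
  rewrite addrAC subrr add0r normrZ (ger0_norm (andP t01).1) /= => H.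
  by apply: le_trans (ler_norm _) (le_trans H _); lra.
have cross : 'd (Psi ^~ v' : E -> R^o) u d - 'd (Psi ^~ v : E -> R^o) u d
    <= Luv * (`|v' - vs| + `|v - vs|) * `|d|.
  have := dual_norm_le d (max_lipschitz_v ms Uu Vv' Vv) => /= H.
  apply: le_trans (ler_norm _) (le_trans H _).
  apply: ler_wpM2r => //; apply: ler_wpM2l => //.
  have -> : v' - v = (v' - vs) - (v - vs) by rewrite opprB addrA subrK.
  exact: ler_normB.
have vsmin v0 : V v0 -> - Psi u vs <= - Psi u v0.
  by move=> Vv0; rewrite lerN2 -hu hmax.
have sc := strongly_convex_min_growth (max_strongly_concave ms Uu)
  (max_V_convex ms) Vvs _ vsmin.
have sc1 := sc _ Vv'; have sc2 := sc _ Vv.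
rewrite (_ : u' = u + d); last by rewrite addrC subrK.
rewrite hu in acc.
set n := `|d| in desc cross *; set n1 := `|v' - vs| in cross sc1 *.
set n2 := `|v - vs| in cross sc2 *.
(* The difference of the two sides is (rho m - Luv n)^2 / (2 rho). *)
have young m : Luv * m * n <= rho / 2 * m ^+ 2 + Luv ^+ 2 / rho * n ^+ 2 / 2.
  have : 0 <= (rho * m - Luv * n) ^+ 2 / rho / 2.
    by rewrite !divr_ge0 ?sqr_ge0// ltW.
  have -> : (rho * m - Luv * n) ^+ 2 / rho / 2 =
    rho / 2 * m ^+ 2 + Luv ^+ 2 / rho * n ^+ 2 / 2 - Luv * m * n.
    by field; rewrite gt_eqF.
  lra.
have := young n1; have := young n2.
have : 0 <= Luu * n ^+ 2 by rewrite mulr_ge0 ?sqr_ge0// (max_Luu_ge0 ms).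
lra.
Qed.

(** * The estimate sequence *)

(** The induction behind the convergence rate, for an arbitrary real-valued
    convex phi on D, an arbitrary function B in the role of the Bregman
    distance, and arbitrary weights subject to the growth condition that lets
    B (w t.+1) (ubar t.+1) absorb the quadratic error of the model at z t.+1.
    The minimizing properties of the iterates are hypotheses, so that neither
    differentiability nor extended values intervene. *)
Lemma estimate_sequence_bound (R : realType) (E : normedModType R) (D : set E)
    (h phi : E -> R) (B : E -> E -> R) (mu L : R) (alpha delta hhat : nat -> R)
    (g : nat -> {linear E -> R^o}) (u ubar w z : nat -> E) :
  let A := weight_sum alpha in
  let tau t := alpha t / A t in
  let model t x := hhat t + g t (x - u t) in
  let psi t x := \sum_(i < t.+1) alpha i * model i x + A t * phi x
                 + L * B x (u 0%N) in
  (forall x y t, D x -> D y -> 0 <= t <= 1 ->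
     phi ((1 - t) *: x + t *: y) <= (1 - t) * phi x + t * phi y) ->
  0 <= L ->
  alpha 0%N = 1 -> (forall t, 0 <= alpha t) ->
  (forall t, L * alpha t.+1 ^+ 2 <= (A t * mu + L) * A t.+1) ->
  (forall t, D (z t)) -> (forall t, D (w t.+1)) -> (forall t, D (ubar t.+1)) ->
  (forall t x, D x -> model t x <= h x) ->
  (forall t, h (z t) <=
     model t (z t) + L / 2 * `|z t - u t| ^+ 2 + delta t) ->
  (forall x, D x -> psi 0%N (z 0%N) <= psi 0%N x) ->
  `|z 0%N - u 0%N| ^+ 2 / 2 <= B (z 0%N) (u 0%N) ->
  (forall t x, D x ->
     psi t (ubar t.+1) + (A t * mu + L) * B x (ubar t.+1) <= psi t x) ->
  (forall t x, D x ->
     alpha t.+1 * (model t.+1 (w t.+1) + phi (w t.+1))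
       + (A t * mu + L) * B (w t.+1) (ubar t.+1)
     <= alpha t.+1 * (model t.+1 x + phi x)
       + (A t * mu + L) * B x (ubar t.+1)) ->
  (forall t, `|w t.+1 - ubar t.+1| ^+ 2 / 2 <= B (w t.+1) (ubar t.+1)) ->
  (forall t, 0 <= A t * mu + L) ->
  (forall t, u t.+1 = (1 - tau t.+1) *: z t + tau t.+1 *: ubar t.+1) ->
  (forall t, z t.+1 = (1 - tau t.+1) *: z t + tau t.+1 *: w t.+1) ->
  forall t x, D x ->
    A t * (h (z t) + phi (z t)) <= psi t x + \sum_(i < t.+1) A i * delta i.
Proof.
move=> A tau model psi phi_convex L0 alpha0 alpha_ge0 weights Dz Dw Dubar
  model_le h_le z0_min z0_B growth w_min w_B c_ge0 uE zE.
have eq_ler (a b : R) : a = b -> a <= b by move->.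
have A0 : A 0%N = 1 by rewrite /A /weight_sum big_ord1.
have AS t : A t.+1 = A t + alpha t.+1 by rewrite /A /weight_sum big_ord_recr.
have A_ge1 t : 1 <= A t.
  by elim: t => [|t IH]; rewrite ?A0// AS (le_trans IH)// lerDl.
have psiS t x :
    psi t.+1 x = psi t x + alpha t.+1 * (model t.+1 x + phi x).
  by rewrite /psi big_ord_recr/= AS; ring.
elim=> [|t IH] x Dx.
  apply: (@le_trans _ _ (psi 0%N (z 0%N) + delta 0%N)); last first.
    by rewrite big_ord1 A0 mul1r lerD2r z0_min.
  rewrite /psi big_ord1 alpha0 A0 !mul1r.
  have := h_le 0%N; have := ler_wpM2l L0 z0_B; lra.
have {}IH := IH _ (Dubar t).
have := growth t x Dx; have := w_min t x Dx; have := weights t.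
have := model_le t.+1 _ (Dz t); have := h_le t.+1; have := w_B t.
have := c_ge0 t.
have := A_ge1 t; have := alpha_ge0 t.+1.
rewrite psiS big_ord_recr/=.
set c := A t * mu + L; set a := alpha t.+1.
move=> a0 A1 c0 wB hz' lz wts wmin gr.
have A'0 : 0 < A t.+1 by rewrite (lt_le_trans ltr01).
have AA' : A t.+1 = A t + a := AS t.
have tau01 : 0 <= tau t.+1 <= 1.
  rewrite /tau -/a divr_ge0 ?(ltW A'0)//= ler_pdivrMr// mul1r AA' lerDr.
  exact: le_trans ler01 A1.
have tauA : A t.+1 * tau t.+1 = a by rewrite /tau mulrC divfK// gt_eqF.
have tauB : A t.+1 * (1 - tau t.+1) = A t by rewrite mulrBr mulr1 tauA AA' addrK.
(* The step size is kept abstract: only the two identities below matter. *)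
move: (zE t) (uE t) tau01 tauA tauB.
generalize (tau t.+1) => T zE' uE' T01 TA TB.
have phi' : A t.+1 * phi (z t.+1) <= A t * phi (z t) + a * phi (w t.+1).
  have := ler_wpM2l (ltW A'0) (phi_convex _ _ _ (Dz t) (Dw t) T01).
  rewrite -zE' => /le_trans; apply.
  by apply: eq_ler; rewrite -TB -TA; ring.
have model' : A t.+1 * model t.+1 (z t.+1) =
    A t * model t.+1 (z t) + a * model t.+1 (w t.+1).
  rewrite /model zE' !linearB linearD !linearZ/=.
  by rewrite /GRing.scale/= -TB -TA; ring.
have dist : A t.+1 * (L / 2 * `|z t.+1 - u t.+1| ^+ 2)
    <= c * B (w t.+1) (ubar t.+1).
  have -> : z t.+1 - u t.+1 = T *: (w t.+1 - ubar t.+1).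
    by rewrite zE' uE' scalerBr opprD addrACA subrr add0r.
  apply: le_trans (ler_wpM2l c0 wB).
  have -> : `|T *: (w t.+1 - ubar t.+1)| ^+ 2 =
      T ^+ 2 * `|w t.+1 - ubar t.+1| ^+ 2.
    by rewrite normrZ exprMn real_normK ?num_real.
  set N := `|w t.+1 - ubar t.+1| ^+ 2.
  have N0 : 0 <= N by exact: exprn_ge0.
  (* The growth condition on the weights, divided by A t.+1. *)
  have key : A t.+1 * L * T ^+ 2 <= c.
    rewrite -(ler_pM2r A'0); apply: le_trans wts; apply: eq_ler.
    by rewrite -TA; ring.
  have := ler_wpM2r N0 key; lra.
have := ler_wpM2l (ltW A'0) hz'.
move: model'.
have := ler_wpM2l (le_trans ler01 A1) lz.
lra.
Qed.

(** * Weights *)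

Lemma weight_gt0 (R : realType) (theta : R) (t : nat) :
  0 < theta -> 0 < weight theta t.
Proof.
move=> th0; case: t => [|t] //=.
by rewrite mulr_gt0 ?sqrtr_gt0// exprn_gt0// addr_gt0// sqrtr_gt0.
Qed.

Lemma weight_sumE (R : realType) (theta : R) (t : nat) :
  weight_sum (weight theta) t = (1 + Num.sqrt theta) ^+ t.
Proof.
rewrite /weight_sum; elim: t => [|t IH]; first by rewrite big_ord1 expr0.
by rewrite big_ord_recr/= IH/= -[X in X + _]mulr1 -mulrDr -exprSr.
Qed.

(** With q = 1 + sqrt theta, the left-hand side is L theta q^(2t) = mu q^(2t),
    and the right-hand side is at least mu q^t q^(t+1). *)
Lemma weight_growth (R : realType) (mu L : R) (t : nat) :
  0 < mu -> 0 < L ->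
  let alpha := weight (mu / L) in
  L * alpha t.+1 ^+ 2 <=
    (weight_sum alpha t * mu + L) * weight_sum alpha t.+1.
Proof.
move=> mu0 L0 /=; rewrite !weight_sumE /=.
have th0 : 0 <= mu / L by rewrite divr_ge0 // ltW.
have s0 : 0 <= Num.sqrt (mu / L) by exact: sqrtr_ge0.
rewrite exprMn sqr_sqrtr// [X in _ <= _ * X]exprS.
have Q0 : 1 <= (1 + Num.sqrt (mu / L)) ^+ t by apply: exprn_ege1; lra.
set Q := _ ^+ t in Q0 *.
rewrite mulrC -mulrA divfK ?gt_eqF// expr2.
have : 0 <= Num.sqrt (mu / L) * (Q * mu * Q + L * Q).
  by rewrite mulr_ge0// addr_ge0// ?mulr_ge0//; lra.
have : 0 <= L * Q by rewrite mulr_ge0//; lra.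
lra.
Qed.

Lemma weight_sum_gt0 (R : realType) (alpha : nat -> R) (t : nat) :
  (forall i, 0 < alpha i) -> 0 < weight_sum alpha t.
Proof.
move=> a0; rewrite /weight_sum big_ord_recl; apply: ltr_wpDr => //.
by apply: sumr_ge0 => i _; exact: ltW.
Qed.

Lemma weight_ratio01 (R : realType) (alpha : nat -> R) (t : nat) :
  (forall i, 0 < alpha i) -> 0 <= alpha t.+1 / weight_sum alpha t.+1 <= 1.
Proof.
move=> a0; have A0 := weight_sum_gt0 t.+1 a0.
rewrite divr_ge0 ?(ltW A0) ?(ltW (a0 _))//= ler_pdivrMr// mul1r.
by rewrite /weight_sum big_ord_recr/= lerDr sumr_ge0// => i _; exact: ltW.
Qed.

(** * Bregman distances of distance generating functions *)

Definition finite_bregman (R : realType) (E : normedModType R)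
    (omega : E -> \bar R) (x p : E) : R :=
  fine (omega x) - fine (omega p) - egrad omega p (x - p).

Lemma dgf_fineE (R : realType) (E : normedModType R) (U : set E)
    (omega : E -> \bar R) (x : E) :
  is_dgf U omega -> U x -> omega x = (fine (omega x))%:E.
Proof.
move=> dgf Ux; rewrite fineK// fin_numE (dgf_neqNy dgf) /=.
by rewrite lt_eqF//; exact: (dgf_fin dgf).
Qed.

Lemma bregmanE (R : realType) (E : normedModType R) (U : set E)
    (omega : E -> \bar R) (x p : E) :
  is_dgf U omega -> U x -> U p ->
  bregman omega x p = (finite_bregman omega x p)%:E.
Proof.
move=> dgf Ux Up.
by rewrite /bregman (dgf_fineE dgf Ux) (dgf_fineE dgf Up) -!EFinB.
Qed.

(** The tangent inequality of the 1-strongly convex function omega at p, where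
    omega is differentiable. *)
Lemma finite_bregman_ge (R : realType) (E : normedModType R) (U : set E)
    (omega : E -> \bar R) (x p : E) :
  is_dgf U omega -> U x -> dgf_interior U omega p ->
  `|x - p| ^+ 2 / 2 <= finite_bregman omega x p.
Proof.
move=> dgf Ux [Up ip].
have [diff _ _] := dgf_essentially_smooth dgf.
have := strongly_convex_on_gradient (dgf_strongly_convex dgf) Ux Up (diff p ip).
rewrite /finite_bregman /egrad; set N := `|x - p| ^+ 2; lra.
Qed.

(** The set U is compact, and the Bregman distance to p is continuous on it
    because the differential of omega at the interior point p is a continuous
    linear form. *)
Lemma bregman_radius_attained (R : realType) (E : normedModType R) (U : set E)
    (omega : E -> \bar R) (p : E) :
  finite_dim E -> closed U -> bounded_set U -> is_dgf U omega ->
  dgf_interior U omega p ->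
  exists2 x, U x & bregman_radius U omega p = bregman omega x p.
Proof.
move=> finE clU bndU dgf [Up ip].
have [diff_omega _ _] := dgf_essentially_smooth dgf.
have cU := finite_dim_bounded_closed_compact finE bndU clU.
have cB : {within U, continuous (fun x => finite_bregman omega x p)}.
  move=> x; apply: cvgB; first apply: cvgB; first exact: dgf_continuous dgf x.
    exact: cvg_cst.
  apply: (@continuous_subspaceT _ _ U (fun x => egrad omega p (x - p))) => y.
  apply: (@continuous_comp _ _ _ (fun x => x - p) (egrad omega p)).
    by apply: cvgB; [exact: cvg_id | exact: cvg_cst].
  exact: diff_continuous (diff_omega p ip) _.
have [x /set_mem Ux xmax] := compact_EVT_max (ex_intro _ p Up) cU cB.
exists x => //; apply/le_anti/andP; split.
  apply: ge_ereal_sup => _ [y Uy <-].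
  by rewrite !(bregmanE dgf)// lee_fin xmax// mem_set.
by apply: ereal_sup_ubound; exists x.
Qed.

(** * Minimization of extended-valued functions *)

(** Up to a real-valued part and a positive factor, every subproblem of the
    method has zeta as its only possibly infinite term. Since zeta is finite
    somewhere on U, infinite values can be discarded. *)
Lemma is_argmin_finite (R : realType) (E : normedModType R) (U : set E)
    (zeta f : E -> \bar R) (r : E -> R) (c : R) (x : E) :
  (forall y, zeta y != -oo%E) -> 0 < c -> (U `&` edom zeta) !=set0 ->
  (forall y, U y -> f y = ((r y)%:E + c%:E * zeta y)%E) ->
  is_argmin U f x <->
  (U `&` edom zeta) x /\ forall y, (U `&` edom zeta) y ->
    r x + c * fine (zeta x) <= r y + c * fine (zeta y).
Proof.
move=> zNy c0 [y0 [Uy0 zy0]] fE.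
have fin y : edom zeta y -> zeta y = (fine (zeta y))%:E.
  by move=> zy; rewrite fineK// fin_numE zNy lt_eqF.
have infty y : U y -> ~ edom zeta y -> f y = +oo%E.
  move=> Uy /negP; rewrite -leNgt leye_eq => /eqP zy.
  by rewrite fE// zy gt0_muley.
split=> [[Ux xmin]|[[Ux zx] xmin]].
- have zx : edom zeta x.
    apply/not_notP => /(infty _ Ux) fx.
    by have := xmin _ Uy0; rewrite fx fE// fin.
  split=> // y [Uy zy]; have := xmin _ Uy.
  by rewrite !fE// (fin _ zx) (fin _ zy) -!EFinM -!EFinD lee_fin.
- split=> // y Uy; have [zy|/(infty _ Uy)->] := pselect (edom zeta y).
    rewrite !fE// (fin _ zx) (fin _ zy) -!EFinM -!EFinD lee_fin.
    exact: xmin.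
  exact: leey.
Qed.

Lemma finite_part_convex (R : realType) (E : normedModType R) (U : set E)
    (zeta : E -> \bar R) :
  (forall y, zeta y != -oo%E) -> convex_set U -> econvex_on U zeta ->
  forall x y (t : R), (U `&` edom zeta) x -> (U `&` edom zeta) y ->
    0 <= t <= 1 ->
    (U `&` edom zeta) ((1 - t) *: x + t *: y) /\
    fine (zeta ((1 - t) *: x + t *: y)) <=
      (1 - t) * fine (zeta x) + t * fine (zeta y).
Proof.
move=> zNy cU cz x y t [Ux zx] [Uy zy] t01.
have fin w : edom zeta w -> zeta w = (fine (zeta w))%:E.
  by move=> zw; rewrite fineK// fin_numE zNy lt_eqF.
have := cz y x t Uy Ux t01; rewrite (fin _ zx) (fin _ zy) -!EFinM -EFinD.
rewrite [in X in zeta X]addrC => zle.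
have zxy : edom zeta ((1 - t) *: x + t *: y) by exact: le_lt_trans zle (ltry _).
split; first by split=> //; exact: convex_setP.
by move: zle; rewrite fin// lee_fin [X in _ <= X]addrC.
Qed.

Lemma objective_finite (R : realType) (E : normedModType R) (U : set E)
    (f : E -> R) (zeta omega : E -> \bar R) (mu : R) (x : E) :
  is_dgf U omega -> (forall y, zeta y != -oo%E) -> (U `&` edom zeta) x ->
  ((f x)%:E + zeta x + mu%:E * omega x)%E =
    (f x + (fine (zeta x) + mu * fine (omega x)))%:E.
Proof.
move=> dgf zNy [Ux zx]; rewrite (dgf_fineE dgf Ux) /=.
have -> : zeta x = (fine (zeta x))%:E by rewrite fineK// fin_numE zNy lt_eqF.
by rewrite -EFinM -!EFinD addrA.
Qed.

Lemma optimal_value_argmin (R : realType) (E : normedModType R) (U : set E)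
    (h : E -> R) (zeta omega : E -> \bar R) (mu : R) (x : E) :
  is_argmin U (objective h zeta omega mu) x ->
  optimal_value U h zeta omega mu = objective h zeta omega mu x.
Proof.
move=> [Ux xmin]; apply/le_anti/andP; split.
  by apply: ereal_inf_lbound; exists x.
by apply: le_ereal_inf_tmp => _ [y Uy <-]; exact: xmin.
Qed.

(** * Proximal problems *)

Lemma linear_form_combination (R : realType) (E : lmodType R)
    (f g : {linear E -> R^o}) (a b : R) :
  exists k : {linear E -> R^o}, forall x, k x = a * f x + b * g x.
Proof. by exists (a \*: f \+ b \*: g). Qed.

Lemma sum_linear_form (R : realType) (E : lmodType R) (a : nat -> R)
    (g : nat -> {linear E -> R^o}) (t : nat) :
  exists k : {linear E -> R^o}, forall x, k x = \sum_(i < t) a i * g i x.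
Proof.
elim: t => [|t [k kE]].
  have [k kE] := linear_form_combination (g 0%N) (g 0%N) 0 0.
  by exists k => x; rewrite kE big_ord0 !mul0r addr0.
have [k' k'E] := linear_form_combination k (g t) 1 (a t).
by exists k' => x; rewrite k'E kE big_ord_recr/= mul1r.
Qed.

Lemma prox_dom_neq0 (R : realType) (E : normedModType R) (U : set E)
    (zeta omega : E -> \bar R) (xi : {linear E -> R^o}) :
  prox_solvable U zeta omega -> (U `&` edom zeta) !=set0.
Proof.
move=> /(_ xi 1 ltr01)[x [[Ux _] _ _ zx]]; by exists x.
Qed.

(** After division by a, p minimizes the proximal problem with linear form
    xi / a and parameter a / c; the unique solution of that problem is
    interior. *)
Lemma prox_argmin_interior (R : realType) (E : normedModType R) (U : set E)
    (zeta omega : E -> \bar R) (xi : {linear E -> R^o}) (k a c : R) (p : E) :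
  is_dgf U omega -> (forall y, zeta y != -oo%E) ->
  prox_solvable U zeta omega -> 0 < a -> 0 < c ->
  (U `&` edom zeta) p ->
  (forall y, (U `&` edom zeta) y ->
    xi p + c * fine (omega p) + k + a * fine (zeta p) <=
    xi y + c * fine (omega y) + k + a * fine (zeta y)) ->
  dgf_interior U omega p.
Proof.
move=> dgf zNy prox a0 c0 Dp pmin.
have [xi' xi'E] := linear_form_combination xi xi a^-1 0.
have ac0 : 0 < a / c by rewrite divr_gt0.
have [x [_ xuniq xint _]] := prox xi' _ ac0.
suff -> : p = x by [].
apply: xuniq.
apply/(is_argmin_finite (r := fun y => xi' y + (a / c)^-1 * fine (omega y)) p zNy
  ltr01 (ex_intro _ p Dp)).
  move=> y Uy; rewrite (dgf_fineE dgf Uy) mul1e -EFinM EFinD.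
  by rewrite /= -addeA addeC.
split=> // y Dy; rewrite !mul1r -(ler_pM2l a0) !xi'E !mul0r !addr0 invf_div.
have e v q b : a * (a^-1 * v + c / a * q + b) = v + c * q + a * b.
  by field; rewrite gt_eqF.
rewrite !e; have := pmin y Dy; lra.
Qed.

Lemma argmin_objective_dom (R : realType) (E : normedModType R) (U : set E)
    (h : E -> R) (zeta omega : E -> \bar R) (mu : R) (x : E) :
  is_dgf U omega -> (forall y, zeta y != -oo%E) ->
  (U `&` edom zeta) !=set0 ->
  is_argmin U (objective h zeta omega mu) x -> (U `&` edom zeta) x.
Proof.
move=> dgf zNy D0 xopt.
have [|? _ //] := (is_argmin_finite (r := fun y => h y + mu * fine (omega y))
  x zNy ltr01 D0 _).1 xopt.
move=> y Uy; rewrite /objective (dgf_fineE dgf Uy) /= mul1e EFinD EFinM.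
by rewrite addeAC.
Qed.

(** * Iterates of the accelerated method *)

(** The update of s starts from g 0 with coefficient 1, which is alpha 0. *)
Lemma apg_slope_sum (R : realType) (E : normedModType R)
    (U : set E) (zeta omega : E -> \bar R) (mu L : R) (alpha : nat -> R)
    (g : nat -> {linear E -> R^o}) (s : nat -> E -> R) (u ubar w z : nat -> E) :
  alpha 0%N = 1 ->
  APG_updates U zeta omega mu L alpha g s u ubar w z ->
  forall t x, s t x = \sum_(i < t.+1) alpha i * g i x.
Proof.
move=> alpha0 upd; elim=> [|t IH] x.
  by rewrite big_ord1 alpha0 mul1r (APG_s0 upd).
by rewrite big_ord_recr/= (APG_s upd) IH.
Qed.

Lemma apg_z0_min (R : realType) (E : normedModType R)
    (U : set E) (zeta omega : E -> \bar R) (mu L : R) (alpha : nat -> R)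
    (g : nat -> {linear E -> R^o}) (s : nat -> E -> R) (u ubar w z : nat -> E) :
  is_dgf U omega -> (forall y, zeta y != -oo%E) ->
  (U `&` edom zeta) !=set0 ->
  APG_updates U zeta omega mu L alpha g s u ubar w z ->
  let obj y := s 0%N y + (fine (zeta y) + mu * fine (omega y))
               + L * finite_bregman omega y (u 0%N) in
  (U `&` edom zeta) (z 0%N) /\
  forall y, (U `&` edom zeta) y -> obj (z 0%N) <= obj y.
Proof.
move=> dgf zNy D0 upd obj.
have [Uu0 _] := APG_u0 upd.
have [|Dx xmin] := (is_argmin_finite
  (r := fun y => s 0%N y + mu * fine (omega y)
                 + L * finite_bregman omega y (u 0%N)) (z 0%N) zNy ltr01 D0 _).1
  (APG_z0 upd).
  move=> y Uy; rewrite (dgf_fineE dgf Uy) (bregmanE dgf Uy Uu0) /=.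
  case: (zeta y) (zNy y) => [q _|_|//].
    by rewrite -?(EFinM, EFinD); congr (_%:E); ring.
  by rewrite -!EFinM mul1e addey// !addye// addey.
split=> // y Dy; rewrite /obj; have := xmin y Dy; lra.
Qed.

Lemma apg_ubar_min (R : realType) (E : normedModType R)
    (U : set E) (zeta omega : E -> \bar R) (mu L : R) (alpha : nat -> R)
    (g : nat -> {linear E -> R^o}) (s : nat -> E -> R) (u ubar w z : nat -> E)
    (t : nat) :
  is_dgf U omega -> (forall y, zeta y != -oo%E) ->
  (U `&` edom zeta) !=set0 -> 0 < weight_sum alpha t ->
  APG_updates U zeta omega mu L alpha g s u ubar w z ->
  let obj y := s t y + weight_sum alpha t * (fine (zeta y) + mu * fine (omega y))
               + L * finite_bregman omega y (u 0%N) in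
  (U `&` edom zeta) (ubar t.+1) /\
  forall y, (U `&` edom zeta) y -> obj (ubar t.+1) <= obj y.
Proof.
move=> dgf zNy D0 A0 upd obj.
have [Uu0 _] := APG_u0 upd.
have [|Dx xmin] := (is_argmin_finite
  (r := fun y => s t y + weight_sum alpha t * (mu * fine (omega y))
                 + L * finite_bregman omega y (u 0%N)) (ubar t.+1) zNy A0 D0 _).1
  (APG_ubar upd t).
  move=> y Uy; rewrite (dgf_fineE dgf Uy) (bregmanE dgf Uy Uu0) /=.
  case: (zeta y) (zNy y) => [q _|_|//].
    by rewrite -?(EFinM, EFinD); congr (_%:E); ring.
  by rewrite -!EFinM addye// gt0_muley// addey// addye// addey.
split=> // y Dy; rewrite /obj; have := xmin y Dy; lra.
Qed.

Lemma apg_w_min (R : realType) (E : normedModType R)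
    (U : set E) (zeta omega : E -> \bar R) (mu L : R) (alpha : nat -> R)
    (g : nat -> {linear E -> R^o}) (s : nat -> E -> R) (u ubar w z : nat -> E)
    (t : nat) :
  is_dgf U omega -> (forall y, zeta y != -oo%E) ->
  (U `&` edom zeta) !=set0 -> 0 < alpha t.+1 -> U (ubar t.+1) ->
  APG_updates U zeta omega mu L alpha g s u ubar w z ->
  let obj y := alpha t.+1 * (g t.+1 y + (fine (zeta y) + mu * fine (omega y)))
    + (weight_sum alpha t * mu + L) * finite_bregman omega y (ubar t.+1) in
  (U `&` edom zeta) (w t.+1) /\
  forall y, (U `&` edom zeta) y -> obj (w t.+1) <= obj y.
Proof.
move=> dgf zNy D0 a0 Uub upd obj.
have [|Dx xmin] := (is_argmin_finite
  (r := fun y => alpha t.+1 * (g t.+1 y + mu * fine (omega y))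
    + (weight_sum alpha t * mu + L) * finite_bregman omega y (ubar t.+1))
  (w t.+1) zNy a0 D0 _).1 (APG_w upd t).
  move=> y Uy; rewrite (dgf_fineE dgf Uy) (bregmanE dgf Uy Uub) /=.
  case: (zeta y) (zNy y) => [q _|_|//].
    by rewrite -?(EFinM, EFinD); congr (_%:E); ring.
  by rewrite -!EFinM addey// addye// gt0_muley// addye// addey.
split=> // y Dy; rewrite /obj; have := xmin y Dy; lra.
Qed.

(** The averaged points z and u stay in the domain by convexity. That ubar is
    interior is read off the proximal problem with linear form
    s_t - L grad omega(u_0) and coefficient A_t mu + L in front of omega. *)
Lemma apg_iterates (R : realType) (E : normedModType R)
    (U : set E) (zeta omega : E -> \bar R) (mu L : R) (alpha : nat -> R)
    (g : nat -> {linear E -> R^o}) (s : nat -> E -> R) (u ubar w z : nat -> E) :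
  convex_set U -> is_dgf U omega -> (forall y, zeta y != -oo%E) ->
  econvex_on U zeta -> prox_solvable U zeta omega ->
  0 < mu -> 0 < L -> alpha 0%N = 1 -> (forall t, 0 < alpha t) ->
  APG_updates U zeta omega mu L alpha g s u ubar w z ->
  [/\ forall t, (U `&` edom zeta) (z t),
      forall t, (U `&` edom zeta) (w t.+1),
      forall t, (U `&` edom zeta) (ubar t.+1),
      forall t, dgf_interior U omega (ubar t.+1)
    & forall t, U (u t)].
Proof.
move=> cU dgf zNy cz prox mu0 L0 alpha0 a0 upd.
have D0 := prox_dom_neq0 (g 0%N) prox.
have Du t := apg_ubar_min dgf zNy D0 (weight_sum_gt0 t a0) upd.
have Dz0 := (apg_z0_min dgf zNy D0 upd).1.
have Dw t := (apg_w_min dgf zNy D0 (a0 t.+1) (Du t).1.1 upd).1.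
have Dz t : (U `&` edom zeta) (z t).
  elim: t => [//|t IH]; rewrite (APG_z upd).
  exact: (finite_part_convex zNy cU cz IH (Dw t) (weight_ratio01 t a0)).1.
split=> //; first by move=> t; exact: (Du t).1.
  move=> t; have [Dub ubmin] := Du t.
  have A0 := weight_sum_gt0 t a0.
  have [xi xiE] := sum_linear_form alpha g t.+1.
  have [xi' xi'E] := linear_form_combination xi (egrad omega (u 0%N)) 1 (- L).
  apply: (prox_argmin_interior (xi := xi')
    (k := L * (egrad omega (u 0%N) (u 0%N) - fine (omega (u 0%N))))
    (a := weight_sum alpha t) (c := weight_sum alpha t * mu + L)) => //.
    by rewrite addr_gt0// mulr_gt0.
  move=> y Dy; rewrite !xi'E !xiE -!(apg_slope_sum alpha0 upd).
  have := ubmin y Dy; rewrite /finite_bregman !linearB /=; lra.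
case=> [|t]; first by have [] := APG_u0 upd.
rewrite (APG_u upd).
exact: convex_setP (Dz t).1 (Du t).1.1 (weight_ratio01 t a0).
Qed.

(** The estimate-sequence bound applies with phi = zeta + mu omega on the points
    of U where zeta is finite. The point that needs an argument is the growth
    of psi_t away from ubar: psi_t is the sum of (A_t mu + L) omega and of the
    convex function rest below, so first-order optimality at ubar turns the
    linearization of omega into a Bregman distance. *)
Lemma apg_bound (R : realType) (E : normedModType R)
    (U : set E) (h : E -> R) (zeta omega : E -> \bar R) (mu L : R)
    (alpha delta hhat : nat -> R)
    (g : nat -> {linear E -> R^o}) (s : nat -> E -> R) (u ubar w z : nat -> E) :
  convex_set U -> is_dgf U omega -> (forall y, zeta y != -oo%E) ->
  econvex_on U zeta -> prox_solvable U zeta omega ->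
  0 < mu -> 0 < L -> alpha 0%N = 1 -> (forall t, 0 < alpha t) ->
  (forall t, L * alpha t.+1 ^+ 2 <=
     (weight_sum alpha t * mu + L) * weight_sum alpha t.+1) ->
  APG_updates U zeta omega mu L alpha g s u ubar w z ->
  (forall t, is_FOA U h (delta t) L (u t) (hhat t) (g t)) ->
  let A := weight_sum alpha in
  let phi x := fine (zeta x) + mu * fine (omega x) in
  forall t x, (U `&` edom zeta) x ->
    A t * (h (z t) + phi (z t)) <=
      \sum_(i < t.+1) alpha i * (hhat i + g i (x - u i)) + A t * phi x
      + L * finite_bregman omega x (u 0%N) + \sum_(i < t.+1) A i * delta i.
Proof.
move=> cU dgf zNy cz prox mu0 L0 alpha0 a0 weights upd foa A phi.
have [Dz Dw Dub iub Uu] := apg_iterates cU dgf zNy cz prox mu0 L0 alpha0 a0 upd.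
have D0 := prox_dom_neq0 (g 0%N) prox.
have ub_min t := (apg_ubar_min dgf zNy D0 (weight_sum_gt0 t a0) upd).2.
have z0_min := (apg_z0_min dgf zNy D0 upd).2.
have w_min t := (apg_w_min dgf zNy D0 (a0 t.+1) (Dub t).1 upd).2.
have convD := finite_part_convex zNy cU cz.
have [diff_omega _ _] := dgf_essentially_smooth dgf.
have A_gt0 t : 0 < A t by exact: weight_sum_gt0.
have slopeE := apg_slope_sum alpha0 upd.
have modelE t x : \sum_(i < t.+1) alpha i * (hhat i + g i (x - u i)) =
    s t x + \sum_(i < t.+1) alpha i * (hhat i - g i (u i)).
  rewrite slopeE -big_split/=; apply: eq_bigr => i _.
  by rewrite linearB/= ; ring.
apply: (@estimate_sequence_bound R E (U `&` edom zeta) h phi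
  (finite_bregman omega) mu L alpha delta hhat g u ubar w z) => //.
- move=> x y t Dx Dy t01; have [[Uxy _] cxy] := convD x y t Dx Dy t01.
  have t01' : 0 <= 1 - t <= 1 by lra.
  have := dgf_strongly_convex dgf Dx.1 Dy.1 t01'.
  rewrite (_ : 1 - (1 - t) = t); last by ring.
  have : 0 <= 1 / 2 * ((1 - t) * t) * `|x - y| ^+ 2.
    by rewrite !mulr_ge0 ?sqr_ge0//; lra.
  rewrite /phi => n0 sc.
  have : mu * fine (omega ((1 - t) *: x + t *: y)) <=
      mu * ((1 - t) * fine (omega x) + t * fine (omega y)).
    by rewrite ler_pM2l//; lra.
  lra.
- exact: ltW.
- by move=> t; exact: ltW.
- by move=> t x [Ux _]; exact: ((foa t).2 x Ux).1.
- by move=> t; exact: ((foa t).2 _ (Dz t).1).2.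
- move=> x Dx; rewrite !modelE /weight_sum !big_ord1 alpha0 !mul1r.
  by have := z0_min x Dx; rewrite /phi; lra.
- exact: (finite_bregman_ge dgf (Dz 0%N).1 (APG_u0 upd)).
- move=> t x Dx.
  set c := weight_sum alpha t * mu + L.
  have c0 : 0 < c by rewrite addr_gt0// mulr_gt0// A_gt0.
  have [xi xiE] := sum_linear_form alpha g t.+1.
  pose k := \sum_(i < t.+1) alpha i * (hhat i - g i (u i)).
  pose G := egrad omega (u 0%N).
  pose rest y := xi y + k + A t * fine (zeta y)
                 - L * (fine (omega (u 0%N)) + G (y - u 0%N)).
  (* The distance to u 0 contributes L * omega to the term c * omega; its
     affine remainder goes into rest. *)
  have psiE y : \sum_(i < t.+1) alpha i * (hhat i + g i (y - u i))
      + weight_sum alpha t * phi y + L * finite_bregman omega y (u 0%N) =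
      rest y + c * fine (omega y).
    by rewrite modelE slopeE -xiE /rest /phi /finite_bregman /c /A -/G -/k; ring.
  rewrite !psiE.
  have rest_convex y1 y2 (r : R) : (U `&` edom zeta) y1 ->
      (U `&` edom zeta) y2 -> 0 <= r <= 1 ->
      (U `&` edom zeta) ((1 - r) *: y1 + r *: y2) /\
      rest ((1 - r) *: y1 + r *: y2) <= (1 - r) * rest y1 + r * rest y2.
    move=> D1 D2 r01; have [D12 c12] := convD _ _ _ D1 D2 r01; split=> //.
    have := ler_wpM2l (ltW (A_gt0 t)) c12.
    rewrite /rest !linearB !linearD !linearZ/= /GRing.scale/=; lra.
  have pmin y : (U `&` edom zeta) y ->
      rest (ubar t.+1) + c * fine (omega (ubar t.+1)) <=
      rest y + c * fine (omega y).
    move=> Dy; rewrite -!psiE !modelE.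
    by have := ub_min t y Dy; rewrite /phi; lra.
  have := minimizer_first_order rest_convex c0 (diff_omega _ (iub t).2)
    (Dub t) Dx pmin.
  rewrite /finite_bregman /egrad; lra.
- move=> t x Dx; have := w_min t x Dx.
  rewrite /phi !linearB/=; lra.
- by move=> t; exact: (finite_bregman_ge dgf (Dw t).1 (iub t)).
- by move=> t; rewrite addr_ge0 ?mulr_ge0 ?(ltW (A_gt0 t)) ?ltW.
- exact: APG_u upd.
- exact: APG_z upd.
Qed.

Theorem theorem5p2 (R : realType) (E : normedModType R) (U U' : set E)
    (h : E -> R) (zeta omega : E -> \bar R) (mu : R) (ustar : E)
    (finE : finite_dim E)
    (U_neq0 : U !=set0) (U_closed : closed U) (U_convex : convex_set U)
    (omega_dgf : is_dgf U omega)
    (U'_open : open U') (U_sub : U `<=` U')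
    (h_convex : convex_function (E := E) U (h : E -> R^o))
    (h_diff : forall u, U' u -> differentiable (h : E -> R^o) u)
    (zeta_neqNy : forall u, zeta u != -oo%E)
    (zeta_convex : econvex_on U zeta)
    (zeta_closed : closed_function zeta)
    (prox : prox_solvable U zeta omega)
    (mu_gt0 : 0 < mu)
    (ustar_int : dgf_interior U omega ustar)
    (ustar_opt : is_argmin U (objective h zeta omega mu) ustar) :
  (forall (Lh Lbar : R) (delta : nat -> R)
      (hhat : nat -> R) (g : nat -> {linear E -> R^o}) (s : nat -> E -> R)
      (u ubar w z : nat -> E),
    gradient_lipschitz U h Lh ->
    Lh <= Lbar -> 0 < Lbar ->
    (forall t, 0 <= delta t) ->
    let theta := mu / Lbar in
    let q := 1 + Num.sqrt theta in
    APG_updates U zeta omega mu Lbar (weight theta) g s u ubar w z ->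
    (forall t, is_FOA U h (delta t) Lbar (u t) (hhat t) (g t)) ->
    forall t,
      (objective h zeta omega mu (z t) - optimal_value U h zeta omega mu
       <= (q ^- t * Lbar)%:E * bregman omega ustar (u 0%N)
          + (q ^- t * \sum_(i < t.+1) q ^+ i * delta i)%:E)%E)
  /\
  (forall (F : normedModType R) (V V' : set F) (Psi : E -> F -> R)
      (Luu Luv rho : R) (delta : nat -> R) (v : nat -> F)
      (hhat : nat -> R) (g : nat -> {linear E -> R^o}) (s : nat -> E -> R)
      (u ubar w z : nat -> E),
    finite_dim F ->
    max_structure U U' V V' h Psi Luu Luv rho ->
    bounded_set U ->
    (forall t, 0 <= delta t) ->
    let Lh := Luu + Luv ^+ 2 / rho in
    0 < Lh ->
    let Lbar := 2 * Lh in
    let theta := mu / Lbar in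
    let q := 1 + Num.sqrt theta in
    let alpha := weight theta in
    APG_updates U zeta omega mu Lbar alpha g s u ubar w z ->
    (forall t, V (v t) /\ h (u t) - Psi (u t) (v t) <= delta t / 2) ->
    (forall t, hhat t = Psi (u t) (v t)) ->
    (forall t x, g t x = 'd (Psi ^~ (v t) : E -> R^o) (u t) x) ->
    let vbar := fun t : nat =>
      (weight_sum alpha t)^-1 *: \sum_(i < t.+1) alpha i *: v i in
    let Omega := bregman_radius U omega (u 0%N) in
    [/\ exists2 x, U x & bregman omega x (u 0%N) = Omega,
        (Omega < +oo)%E,
        (forall t, is_FOA U h (delta t) Lbar (u t) (hhat t) (g t))
      & forall t,
        (duality_gap U h Psi zeta omega mu (z t) (vbar t)
         <= (2 * q ^- t * Lh)%:E * Omega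
            + (q ^- t * \sum_(i < t.+1) q ^+ i * delta i)%:E)%E]).
Proof.
have D0 := prox_dom_neq0 \0 prox.
have ustarD := argmin_objective_dom omega_dgf zeta_neqNy D0 ustar_opt.
have rate (Lbar : R) (t : nat) : 0 < Lbar ->
    0 < (1 + Num.sqrt (mu / Lbar)) ^+ t.
  by move=> L0; rewrite exprn_gt0// addr_gt0// sqrtr_gt0 divr_gt0.
have errE (theta : R) (delta : nat -> R) (t : nat) :
    \sum_(i < t.+1) weight_sum (weight theta) i * delta i =
    \sum_(i < t.+1) (1 + Num.sqrt theta) ^+ i * delta i.
  by apply: eq_bigr => i _; rewrite weight_sumE.
split.
  move=> Lh Lbar delta hhat g s u ubar w z _ _ L0 delta0 theta q upd foa t.
  have theta0 : 0 < theta by rewrite divr_gt0.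
  have [Dz _ _ _ _] := apg_iterates U_convex omega_dgf zeta_neqNy zeta_convex prox
    mu_gt0 L0 erefl (fun t => weight_gt0 t theta0) upd.
  have := apg_bound U_convex omega_dgf zeta_neqNy zeta_convex prox
    mu_gt0 L0 erefl (fun t => weight_gt0 t theta0)
    (fun t => weight_growth t mu_gt0 L0) upd foa t ustarD.
  have : \sum_(i < t.+1) weight theta i * (hhat i + g i (ustar - u i)) <=
      weight_sum (weight theta) t * h ustar.
    rewrite /weight_sum mulr_suml; apply: ler_sum => i _.
    apply: ler_wpM2l; first exact/ltW/weight_gt0.
    exact: ((foa i).2 _ ustarD.1).1.
  rewrite errE weight_sumE -/q (optimal_value_argmin ustar_opt) /objective.
  rewrite !(objective_finite _ _ omega_dgf zeta_neqNy)//.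
  rewrite (bregmanE omega_dgf ustarD.1 (APG_u0 upd).1).
  rewrite -EFinB -EFinM -EFinD lee_fin.
  set S := \sum_(i < t.+1) q ^+ i * delta i.
  have := rate Lbar t L0; rewrite -/theta -/q => q0.
  move=> h1 h2.
  rewrite -(ler_pM2l q0) -mulrA -mulrDr mulrA divff ?gt_eqF// mul1r.
  lra.
move=> F V V' Psi Luu Luv rho delta v hhat g s u ubar w z finF ms bndU delta0.
move=> Lh Lh0 Lbar theta q alpha upd vacc hhatE gE vbar Omega.
have L0 : 0 < Lbar by rewrite mulr_gt0.
have theta0 : 0 < theta by rewrite divr_gt0.
have a0 t : 0 < alpha t by exact: weight_gt0.
have [Dz _ _ _ Uu] := apg_iterates U_convex omega_dgf zeta_neqNy zeta_convex prox
  mu_gt0 L0 erefl a0 upd.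
have Vv t := (vacc t).1.
have [x0 Ux0 OmegaE] := bregman_radius_attained finE U_closed bndU omega_dgf
  (APG_u0 upd).
have foa t : is_FOA U h (delta t) Lbar (u t) (hhat t) (g t).
  rewrite hhatE; apply: (max_structure_FOA U_convex U_sub ms) => //.
  exact: (vacc t).2.
split=> //.
- by exists x0.
- by rewrite /Omega OmegaE (bregmanE omega_dgf Ux0 (APG_u0 upd).1) ltry.
move=> t.
rewrite /duality_gap /objective (objective_finite _ _ omega_dgf zeta_neqNy)//.
set Pz := h (z t) + _.
have OmegaR : Omega = (fine Omega)%:E.
  by rewrite /Omega OmegaE (bregmanE omega_dgf Ux0 (APG_u0 upd).1).
rewrite OmegaR -EFinM -EFinD; set gap := _ + _ : R.
suff : ((Pz - gap)%:E <= dual_function U Psi zeta omega mu (vbar t))%E.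
  case: (dual_function _ _ _ _ _ _) => [d| |] /=.
  - by rewrite -EFinB !lee_fin; lra.
  - by rewrite leNye.
  - by rewrite leeNy_eq.
apply: le_ereal_inf_tmp => _ [x Ux <-].
have [zx|/negP] := pselect (edom zeta x); last first.
  rewrite -leNgt leye_eq => /eqP->.
  by rewrite (dgf_fineE omega_dgf Ux) -EFinM addey// addye// leey.
rewrite (objective_finite (Psi ^~ (vbar t)) mu omega_dgf zeta_neqNy)//= lee_fin.
have := apg_bound U_convex omega_dgf zeta_neqNy zeta_convex prox
  mu_gt0 L0 erefl a0 (fun t => weight_growth t mu_gt0 L0) upd foa t (conj Ux zx).
have concave y1 y2 (r : R) : V y1 -> V y2 -> 0 <= r <= 1 ->
    (1 - r) * Psi x y1 + r * Psi x y2 <= Psi x ((1 - r) *: y1 + r *: y2).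
  move=> V1 V2 r01; have r01' : 0 <= 1 - r <= 1 by lra.
  have := max_strongly_concave ms Ux V1 V2 r01'.
  rewrite (_ : 1 - (1 - r) = r); last by ring.
  have : 0 <= rho / 2 * ((1 - r) * r) * `|y1 - y2| ^+ 2.
    have := ltW (max_rho_gt0 ms) => rho0.
    by rewrite !mulr_ge0 ?sqr_ge0//; lra.
  lra.
have := (weighted_mean_concave (max_V_convex ms) concave (a0 0%N)
  (fun t => ltW (a0 t)) Vv t).2.
rewrite -/(vbar t).
have : \sum_(i < t.+1) alpha i * (hhat i + g i (x - u i)) <=
    \sum_(i < t.+1) alpha i * Psi x (v i).
  apply: ler_sum => i _; apply: ler_wpM2l; first exact: ltW.
  rewrite hhatE gE.
  exact: (max_structure_linearization U_sub ms (Uu i) Ux (Vv i)).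
have Bx : finite_bregman omega x (u 0%N) <= fine Omega.
  rewrite -lee_fin -OmegaR -(bregmanE omega_dgf Ux (APG_u0 upd).1).
  by apply: ereal_sup_ubound; exists x.
have {Bx} := ler_wpM2l (ltW L0) Bx.
rewrite errE weight_sumE -/q.
have := rate Lbar t L0; rewrite -/theta -/q => q0.
have gapE : q ^+ t * gap =
    Lbar * fine Omega + \sum_(i < t.+1) q ^+ i * delta i.
  by rewrite /gap /Lbar; field; rewrite gt_eqF.
move=> h1 h2 h3 h4.
rewrite -(ler_pM2l q0) mulrBr gapE /Pz.
lra.
Qed.
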